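(* Let $N\ge2$ be an integer, let $U$ be an $N\times N$ matrix-valued rational function which takes unitary values on the unit circle $\mathbb T$ and has no poles outside the closed unit disk, and let \[ M(z)=QU(z^N)\Delta(z)V, \] where $V=\frac1{\sqrt N}\left(e^{-2\pi i\ell j/N}\right)_{\ell,j=0,\ldots,N-1}$, $\Delta(z)=\mathrm{diag}(1,z^{-1},\ldots,z^{-(N-1)})$ and $Q=(U(1)V)^*$ (so that $M(1)=I_N$). Let $m$ be the upper left entry of the wavelet filter $M$. Then the infinite product \[ \prod_{k=1}^\infty m\left(e^{\frac{2\pi iw}{N^k}}\right),\qquad w\in\mathbb R, \] converges (pointwise) to a function belonging to $\mathbf L_2(\mathbb R)$.
   Context: $\mathbb T$ is the unit circle, $*$ denotes conjugate transpose, and $\mathbf L_2(\mathbb R)$ is taken with respect to Lebesgue measure $dw$. The infinite product is the limit of its partial products $\prod_{k=1}^K m(e^{2\pi iw/N^k})$ as $K\to\infty$. With the stated normalization, $m(1)=1$. *)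

(* Defs.v *)
From HB Require Import structures.
From mathcomp Require Import all_boot all_order all_algebra.
From mathcomp Require Import complex.
From mathcomp Require Import all_classical all_reals all_analysis.

Set Implicit Arguments.
Unset Strict Implicit.
Unset Printing Implicit Defensive.

Import Order.TTheory GRing.Theory Num.Theory.
Import numFieldNormedType.Exports.

Local Open Scope ring_scope.
Local Open Scope quotient_scope.

(* A rational function is an element of the field [{fraction {poly F}}]. Poles
   and values are read off a representative reduced to lowest terms, so that
   removable singularities are not counted as poles; [rat_poleE] and
   [rat_evalE] show independence of the chosen representative. *)
Section RationalFunction.
Variable F : fieldType.
Implicit Types (f : {fraction {poly F}}) (p q : {poly F}) (z : F).

Definition rat_num f : {poly F} :=
  let r := frac (repr f) in r.1 %/ gcdp r.1 r.2.

Definition rat_den f : {poly F} :=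
  let r := frac (repr f) in r.2 %/ gcdp r.1 r.2.

Definition rat_pole f z : bool := root (rat_den f) z.

(* Junk value 0 when [f] has a pole at [z]. *)
Definition rat_eval f z : F := (rat_num f).[z] / (rat_den f).[z].

Lemma rat_cross p q : q != 0 ->
  let f := tofrac p / tofrac q in
  [/\ rat_den f != 0, coprimep (rat_num f) (rat_den f)
    & rat_num f * q = p * rat_den f].
Proof.
move=> q0 /=; set f := _ / _; rewrite /rat_num /rat_den /=.
have : f * tofrac (frac (repr f)).2 = tofrac (frac (repr f)).1.
  rewrite -{1}[f]reprK; unlock tofrac; rewrite -[LHS]pi_mul.
  apply/eqmodP => /=; rewrite FracField.equivfE /FracField.mulf.
  by rewrite !numden_Ratio ?mulr1 ?mul1r ?oner_neq0 ?denom_ratioP // mulrC.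
set n := (frac (repr f)).1; set d := (frac (repr f)).2 => fE.
have d0 : d != 0 by exact: denom_ratioP.
have g0 : gcdp n d != 0 by rewrite gcdp_eq0 negb_and d0 orbT.
have nE : n %/ gcdp n d * gcdp n d = n by rewrite divpK ?dvdp_gcdl.
have dE : d %/ gcdp n d * gcdp n d = d by rewrite divpK ?dvdp_gcdr.
split.
- by apply: contra_neq d0 => h; rewrite -dE h mul0r.
- by rewrite coprimep_div_gcd // d0 orbT.
- apply: (mulIf g0); rewrite mulrAC nE -mulrA dE.
  apply/eqP; rewrite -tofrac_eq !tofracM -fE /f mulrAC divfK ?tofrac_eq0 //.
Qed.

Lemma rat_poleE p q z : q != 0 -> coprimep p q ->
  rat_pole (tofrac p / tofrac q) z = root q z.
Proof.
move=> q0 pq; have [_ nd E] := rat_cross p q0; rewrite /rat_pole.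
set n := rat_num _ in nd E *; set d := rat_den _ in nd E *.
have qd : q %| d by rewrite -(@Gauss_dvdpr _ d p q) 1?coprimep_sym // -E dvdp_mulIr.
have dq : d %| q by rewrite -(@Gauss_dvdpr _ q n d) 1?coprimep_sym // E dvdp_mulIr.
by apply/idP/idP => rz; [exact: (root_dvdp dq)|exact: (root_dvdp qd)].
Qed.

Lemma rat_evalE p q z : q.[z] != 0 ->
  ~~ rat_pole (tofrac p / tofrac q) z /\
  rat_eval (tofrac p / tofrac q) z = p.[z] / q.[z].
Proof.
move=> qz; have q0 : q != 0 by apply: contra_neq qz => ->; rewrite horner0.
have [_ nd E] := rat_cross p q0; rewrite /rat_pole /rat_eval.
set n := rat_num _ in nd E *; set d := rat_den _ in nd E *.
have dz : ~~ root d z.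
  have dq : d %| q.
    by rewrite -(@Gauss_dvdpr _ q n d) 1?coprimep_sym // E dvdp_mulIr.
  by apply: contraNN qz => rz; exact: (root_dvdp dq).
split=> //; apply/eqP; rewrite GRing.eqr_div //.
by rewrite -!hornerM E.
Qed.

End RationalFunction.

(* The topology of the modulus: the library only equips an abstract
   [numClosedFieldType] with it, not the concrete carrier [R[i]]. *)
HB.instance Definition _ (R : rcfType) := NormedModule.copy R[i] R[i]^o.

Section WaveletFilter.
Variables (R : realType) (N : nat).
Local Notation C := R[i].

(* exp (i t) *)
Definition expi (t : R) : C := Complex (cos t) (sin t).

Definition no_pole (U : 'M[{fraction {poly C}}]_N) (z : C) : Prop :=
  forall i j, ~~ rat_pole (U i j) z.

Definition mx_eval (U : 'M[{fraction {poly C}}]_N) (z : C) : 'M[C]_N :=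
  map_mx (fun f => rat_eval f z) U.

Definition unitary_on_circle (U : 'M[{fraction {poly C}}]_N) : Prop :=
  forall z : C, `|z| = 1 -> no_pole U z /\ mx_eval U z \is unitarymx.

Definition dft_mx : 'M[C]_N :=
  (sqrtC N%:R)^-1 *:
    \matrix_(l < N, j < N) expi (- (2 * pi * l%:R * j%:R / N%:R)).

Definition delay_mx (z : C) : 'M[C]_N := diag_mx (\row_(l < N) z ^- l).

Definition wavelet_filter (U : 'M[{fraction {poly C}}]_N) (z : C) : 'M[C]_N :=
  let Q := ((mx_eval U 1 *m dft_mx) ^t*)%sesqui in
  Q *m mx_eval U (z ^+ N) *m delay_mx z *m dft_mx.

End WaveletFilter.

(* Membership in the complex space L_2(R) for Lebesgue measure; measurability of
   a complex-valued function is that of its real and imaginary parts. *)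
Definition square_integrable (R : realType) (f : R -> R[i]) : Prop :=
  [/\ measurable_fun setT (fun w => complex.Re (f w)),
      measurable_fun setT (fun w => complex.Im (f w)) &
      (\int[lebesgue_measure]_w ((Normc.normc (f w)) ^+ 2)%:E < +oo)%E].

(* Main.v *)
(* On the unit circle M is unitary, and M(z exp(2 pi i j / N)) has the columns
   of M(z) cyclically shifted by j; so the values of |m|^2 at the N points
   z exp(2 pi i j / N) are the squared moduli of the first row of M(z) and sum
   to 1. In particular |m| <= 1, and since m(1) = 1 and m is smooth,
   |m(exp(2 pi i t)) - 1| = O(|t|): consecutive partial products P_K(w) differ
   by O(|w| / N^K) and converge. Splitting an interval of length N^(K+1) into N
   translates of an interval of length N^K gives, by N^K-periodicity of P_K and
   the sum rule, that |P_K|^2 has integral 1 over every interval of length N^K.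
   Fatou's lemma on the intervals [- N^K / 2, N^K / 2[ then bounds the L_2 norm
   of the limit by 1. *)

From HB Require Import structures.
Require Import Defs.
From mathcomp Require Import all_boot all_order all_algebra.
From mathcomp Require Import complex.
From mathcomp Require Import all_classical all_reals all_analysis.
From mathcomp Require Import measurable_realfun.
From mathcomp Require Import ring lra.
Import Order.TTheory GRing.Theory Num.Theory.
Import numFieldNormedType.Exports.
Local Open Scope classical_set_scope.
Local Open Scope ring_scope.
Set Implicit Arguments.
Unset Strict Implicit.
Unset Printing Implicit Defensive.

(** * Translations and Lebesgue measure *)

Section Translation.
Context {R : realType}.
Implicit Types (a b c L : R) (F : R -> R).
Local Notation mu := (@lebesgue_measure R).

(** The pushforward agrees with [mu] on the intervals []a, b]], and these determine Lebesgue
    measure. *)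
Lemma lebesgue_measureD c (A : set R) : measurable A ->
  pushforward mu (fun x : measurableTypeR R => x + c : measurableTypeR R) A
    = mu A.
Proof.
have mc : measurable_fun setT
  (fun x : measurableTypeR R => x + c : measurableTypeR R).
  exact: measurable_funD.
pose mcM := isMeasurableFun.Build _ _ _ _ _ mc.
pose mcP : {mfun _ >-> _} :=
  HB.pack (fun x : measurableTypeR R => x + c : measurableTypeR R) mcM.
move=> mA; apply/esym.
apply: (@lebesgue_measure_unique R (pushforward mu mcP)) => // _ [[a b]] _ <-.
transitivity (mu `]a - c, b - c]%classic); last first.
  congr (lebesgue_measure _).
  by apply/seteqP; split => x /=; rewrite !in_itv/= ltrBlDr lerBrDr.
rewrite !lebesgue_measure_itv/= !lte_fin ltrD2r -!EFinB.
by rewrite opprD addrACA subrr addr0.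
Qed.

Lemma ge0_integral_itv_shift F a b c :
  measurable_fun setT F -> (forall x, 0 <= F x) ->
  (\int[mu]_(x in `[(a + c)%R, (b + c)%R[) (F x)%:E
    = \int[mu]_(x in `[a, b[) (F (x + c)%R)%:E)%E.
Proof.
move=> mF F0.
have -> : `[a, b[%classic =
    (fun x : measurableTypeR R => x + c : measurableTypeR R)
      @^-1` `[a + c, b + c[.
  by apply/seteqP; split => x /=; rewrite !in_itv/= lerD2r ltrD2r.
have mc : measurable_fun setT
  (fun x : measurableTypeR R => x + c : measurableTypeR R).
  exact: measurable_funD.
rewrite -(ge0_integral_pushforward mc mu (f := EFin \o F)) //=.
- by apply: eq_measure_integral => //= A mA AS; exact/esym/lebesgue_measureD.
- by apply/measurable_EFinP; apply: measurable_funS mF.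
- by move=> x _; rewrite lee_fin.
Qed.

(** Induction on [n]: the last piece, of length [L], is split off and translated back to [[a, a +
    L[]. With [n = N] and [L = N^K] this is the splitting step for the partial products. *)
Lemma ge0_integral_itv_fold F a L n :
  measurable_fun setT F -> (forall x, 0 <= F x) -> 0 <= L ->
  (\int[mu]_(x in `[a, (a + n%:R * L)%R[) (F x)%:E
    = \int[mu]_(x in `[a, (a + L)%R[) (\sum_(j < n) F (x + j%:R * L))%R%:E)%E.
Proof.
move=> mF F0 L0; elim: n => [|n IH].
  rewrite mul0r addr0 set_itv_ge ?bnd_simp ?ltxx// integral_set0.
  by under eq_integral do rewrite big_ord0; rewrite integral0.
have mFs c : measurable_fun setT (fun x : R => F (x + c)).
  by apply: (measurableT_comp mF); exact: measurable_funD.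
rewrite (_ : `[a, _[%classic = `[a, a + n%:R * L[%classic `|`
    `[a + n%:R * L, (a + L) + n%:R * L[%classic); last first.
  have h1 : a <= a + n%:R * L by rewrite lerDl mulr_ge0.
  have h2 : a + n%:R * L <= a + L + n%:R * L by rewrite lerD2r lerDl.
  have h3 : a + n.+1%:R * L = a + L + n%:R * L by rewrite -natr1; ring.
  rewrite h3; apply/seteqP; split => x /=; rewrite !in_itv/=.
    by have [xl|xl] := ltP x (a + n%:R * L) => /andP[-> ->]; [left|right].
  move=> [/andP[-> xl]|/andP[xl ->]]; first exact: lt_le_trans xl _.
  by rewrite (le_trans _ xl).
rewrite ge0_integral_setU//.
- rewrite IH ge0_integral_itv_shift//.
  rewrite -ge0_integralD//.
  + by apply: eq_integral => x _; rewrite big_ord_recr.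
  + by move=> x _; rewrite lee_fin sumr_ge0.
  + apply/measurable_EFinP; apply: (@measurable_funS _ _ _ _ setT) => //.
    by apply: measurable_sum => j; exact: mFs.
  + by move=> x _; rewrite lee_fin.
  + by apply/measurable_EFinP; apply: measurable_funS (mFs _).
- by apply/measurable_EFinP; apply: measurable_funS mF => //; exact/measurableU.
- by move=> x _; rewrite lee_fin.
- rewrite disj_set2E; apply/eqP/seteqP; split => x //=; rewrite !in_itv/=.
  by move=> [/andP[_ xl] /andP[+ _]]; rewrite leNgt xl.
Qed.

End Translation.

(** * The complex exponential and the Fourier matrix *)

Section ExpI.
Context {R : realType}.
Implicit Types s t : R.

Lemma expiD s t : expi (s + t) = expi s * expi t.
Proof. by rewrite /expi cosD sinD; simpc; congr Complex; rewrite addrC. Qed.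

Lemma expi0 : expi (0 : R) = 1.
Proof. by rewrite /expi cos0 sin0. Qed.

Lemma expi_conj t : (expi t)^* = expi (- t).
Proof. by rewrite /expi cosN sinN. Qed.

Lemma normc_expi t : Normc.normc (expi t) = 1.
Proof. by rewrite /expi /= cos2Dsin2 sqrtr1. Qed.

Lemma norm_expi t : `|expi t| = 1.
Proof. by rewrite -[LHS]/((Normc.normc _)%:C%C) normc_expi. Qed.

Lemma expi_neq0 t : expi t != 0.
Proof. by rewrite -normr_gt0 norm_expi ltr01. Qed.

Lemma expiN t : expi (- t) = (expi t)^-1.
Proof.
by apply: (mulfI (expi_neq0 t)); rewrite -expiD subrr expi0 divff ?expi_neq0.
Qed.

Lemma expiMn t n : expi (t * n%:R) = expi t ^+ n.
Proof.
elim: n => [|n IH]; first by rewrite mulr0 expi0.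
by rewrite -natr1 mulrDr mulr1 expiD IH exprSr.
Qed.

Lemma expi2pi : expi (2 * pi : R) = 1.
Proof. by rewrite mulr_natl /expi cos2pi sin2pi. Qed.

(** Length of a chord, by the double-angle formulas. It yields both the Lipschitz bound for [expi]
    and its injectivity near 0. *)
Lemma normc_expi_sub1 t : Normc.normc (expi t - 1) = 2 * `|sin (t / 2)|.
Proof.
set x := t / 2; have -> : t = x *+ 2 by rewrite -mulr_natr divfK.
rewrite /expi cos_mulr2n sin_mulr2n /=.
have h := cos2Dsin2 x.
rewrite -(ger0_norm (_ : 0 <= 2 * `|sin x|)) ?mulr_ge0// -sqrtr_sqr.
congr Num.sqrt; rewrite exprMn real_normK ?num_real//.
have -> : cos x ^+ 2 = 1 - sin x ^+ 2 by rewrite -h; ring.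
have {}h : cos x ^+ 2 = 1 - sin x ^+ 2 by rewrite -h; ring.
ring: h.
Qed.

Lemma normr_sin_le t : `|sin t| <= `|t|.
Proof.
wlog t0 : t / 0 <= t.
  move=> H; have [t0|/ltW t0] := leP 0 t; first exact: H.
  by rewrite -normrN -sinN -[leRHS]normrN H// oppr_ge0.
have [|c _ h] := @MVT_segment R sin cos 0 t t0 (fun x _ => is_derive_sin x).
  by apply: continuous_subspaceT => x; exact: continuous_sin.
move: h; rewrite sin0 !subr0 => ->.
by rewrite normrM ler_piMl// cos_max.
Qed.

Lemma expi_lipschitz s t : Normc.normc (expi s - expi t) <= `|s - t|.
Proof.
have -> : expi s - expi t = expi t * (expi (s - t) - 1).
  by rewrite mulrBr mulr1 -expiD addrCA subrr addr0.
rewrite Normc.normcM normc_expi mul1r normc_expi_sub1.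
have := normr_sin_le ((s - t) / 2); rewrite normrM [`|2^-1|]gtr0_norm; lra.
Qed.

(** A chord of length zero forces [sin (t / 2) = 0], while [sin] is positive on []0, pi[], where
    [|t| / 2] would lie if [t] were nonzero. *)
Lemma expi_eq1 t : `|t| < 2 * pi -> expi t = 1 -> t = 0.
Proof.
move=> tpi e1; have := normc_expi_sub1 t; rewrite e1 subrr Normc.normc0.
move/esym/eqP; rewrite mulf_eq0 pnatr_eq0 /= normr_eq0 => /eqP s0.
apply/eqP; rewrite -normr_le0 leNgt; apply/negP => t0.
have : 0 < sin (`|t| / 2).
  apply: sin_gt0_pi; rewrite divr_gt0//=.
  by rewrite ltr_pdivrMr// mulrC.
case: (leP 0 t) => [/ger0_norm|/ltr0_norm] ->;
  by rewrite ?mulNr ?sinN s0 ?oppr0 ltxx.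
Qed.

End ExpI.

(** * Orthogonality of the N-th roots of unity and unitarity of the Fourier matrix *)

Section DFT.
Context {R : realType}.

(** A geometric sum whose ratio [r] satisfies [r^N = 1] and [r != 1]. Taking [k] real accommodates
    differences of indices of either sign. *)
Lemma sum_expi_roots (N : nat) (k : R) : (0 < N)%N -> expi (2 * pi * k) = 1 ->
  `|k| < N%:R -> k != 0 -> \sum_(j < N) expi (2 * pi * k / N%:R) ^+ j = 0.
Proof.
move=> N0 ek kN k0; set r := expi _.
have NR : N%:R != 0 :> R by rewrite pnatr_eq0 -lt0n.
have r1 : r != 1.
  apply/eqP => /expi_eq1 h.
  have : 2 * pi * k / N%:R = 0.
    apply: h; rewrite -mulrA normrM ger0_norm ?mulr_ge0 ?pi_ge0//.
    rewrite gtr_pMr ?mulr_gt0 ?pi_gt0// normrM normfV (ger0_norm (ler0n _ N)).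
    by rewrite ltr_pdivrMr ?mul1r// ltr0n.
  move/eqP; rewrite !mulf_eq0 invr_eq0 (negbTE NR) (negbTE k0).
  by rewrite (gt_eqF (pi_gt0 R)) pnatr_eq0.
apply: (mulfI (_ : r - 1 != 0)); first by rewrite subr_eq0.
by rewrite -subrX1 mulr0 -expiMn divfK// ek subrr.
Qed.

Lemma expi2piMn n : expi (2 * pi * n%:R : R) = 1.
Proof. by rewrite expiMn expi2pi expr1n. Qed.

Lemma dft_unitary (N : nat) : (0 < N)%N -> dft_mx R N \is unitarymx.
Proof.
move=> N0; have NR : N%:R != 0 :> R by rewrite pnatr_eq0 -lt0n.
have NC : N%:R != 0 :> R[i] by rewrite pnatr_eq0 -lt0n.
apply/unitarymxP/matrixP => l l'; rewrite !mxE.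
have sN : (sqrtC N%:R)^-1 * ((sqrtC N%:R)^-1)^* = N%:R^-1 :> R[i].
  rewrite geC0_conj ?invr_ge0 ?sqrtC_ge0 ?ler0n//.
  by rewrite -invfM -expr2 sqrtCK.
under eq_bigr => j _.
  rewrite !mxE rmorphM /= mulrACA sN expi_conj -expiD opprK.
  rewrite (_ : - (2 * pi * l%:R * j%:R / N%:R) + _ =
     2 * pi * (l'%:R - l%:R) / N%:R * j%:R); last by ring.
  rewrite expiMn; over.
rewrite -mulr_sumr; have [->|ll'] := eqVneq l l'.
  rewrite subrr mulr0 mul0r expi0.
  under eq_bigr do rewrite expr1n.
  by rewrite sumr_const card_ord mulVf.
rewrite sum_expi_roots ?mulr0//.
- by rewrite mulrBr expiD expiN !expi2piMn invr1 mulr1.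
- have := ltn_ord l; have := ltn_ord l'; rewrite -!(ltr_nat R) => h1 h2.
  have := ler0n R l; have := ler0n R l'; rewrite ltr_norml => h3 h4.
  by apply/andP; split; lra.
- by rewrite subr_eq0 eqr_nat; apply: contra ll' => /eqP/val_inj->.
Qed.

End DFT.

(** * Lipschitz estimates *)

Section LocallyLipschitz.
Context {R : realType}.
Implicit Types (f g : R -> R[i]) (t : R) (z w : R[i]).
Local Notation normc := Normc.normc.

Lemma normc_ge0 z : 0 <= normc z.
Proof. by case: z => a b; exact: sqrtr_ge0. Qed.

Lemma normc_distC z w : normc (z - w) = normc (w - z).
Proof. by rewrite -(normcN (w - z)) opprB. Qed.

Lemma ler_normcD z w : normc (z + w) <= normc z + normc w.
Proof. exact: le_normcD. Qed.

Lemma normc_ge_normRe z : `|complex.Re z| <= normc z.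
Proof. by case: z => a b /=; rewrite -sqrtr_sqr ler_wsqrtr// lerDl sqr_ge0. Qed.

Lemma normc_ge_normIm z : `|complex.Im z| <= normc z.
Proof. by case: z => a b /=; rewrite -sqrtr_sqr ler_wsqrtr// lerDr sqr_ge0. Qed.

Lemma normc_le_ReIm z : normc z <= `|complex.Re z| + `|complex.Im z|.
Proof.
case: z => a b /=; rewrite -(ger0_norm (_ : 0 <= `|a| + `|b|))// ?addr_ge0//.
rewrite -sqrtr_sqr ler_wsqrtr// sqrrD !real_normK ?num_real//.
by rewrite lerD2r lerDl mulrn_wge0 ?mulr_ge0.
Qed.

Lemma near_dist_lt t e : 0 < e -> \forall s \near t, `|s - t| < e.
Proof. by move=> e0; near do rewrite distrC; exact: cvgr_dist_lt.
Unshelve. all: by end_near. Qed.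

(* Pointwise Lipschitz estimates are stable under the algebraic operations, and
   give at once the continuity of the partial products and |m(z) - 1| = O(|t|)
   at z = exp(2 pi i t). *)
Definition lip_at f t :=
  exists2 c : R, 0 <= c &
    \forall s \near t, normc (f s - f t) <= c * `|s - t|.

Lemma lip_at_cst z t : lip_at (fun=> z) t.
Proof. by exists 0 => //; near=> s; rewrite subrr Normc.normc0 mul0r.
Unshelve. all: by end_near. Qed.

Lemma lip_atD f g t : lip_at f t -> lip_at g t -> lip_at (fun s => f s + g s) t.
Proof.
move=> [c c0 fc] [d d0 gd]; exists (c + d); first exact: addr_ge0.
near=> s; rewrite opprD addrACA (le_trans (ler_normcD _ _))// mulrDl lerD//.
  by near: s.
by near: s.
Unshelve. all: by end_near. Qed.

Lemma lip_atM f g t : lip_at f t -> lip_at g t -> lip_at (fun s => f s * g s) t.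
Proof.
move=> [c c0 fc] [d d0 gd].
exists (c * (normc (g t) + d) + normc (f t) * d).
  by rewrite addr_ge0 ?mulr_ge0 ?addr_ge0 ?normc_ge0.
near=> s.
have fs : normc (f s - f t) <= c * `|s - t| by near: s.
have gs : normc (g s - g t) <= d * `|s - t| by near: s.
(* Within distance 1 of [t], the modulus of [g s] is at most that of [g t] plus [d]; this explains
   the chosen constant. *)
have s1 : `|s - t| < 1.
  by near: s; apply: near_dist_lt; exact: ltr01.
have gs' : normc (g s) <= normc (g t) + d.
  rewrite -[in leLHS](subrK (g t) (g s)) (le_trans (ler_normcD _ _))// addrC.
  rewrite lerD2l.
  by rewrite (le_trans gs)// ler_piMr// ltW.
have -> : f s * g s - f t * g t = (f s - f t) * g s + f t * (g s - g t) by ring.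
rewrite (le_trans (ler_normcD _ _))// !Normc.normcM mulrDl lerD//.
  by rewrite mulrAC ler_pM ?normc_ge0.
by rewrite -mulrA ler_wpM2l ?normc_ge0.
Unshelve. all: by end_near. Qed.

Lemma lip_atV f t : f t != 0 -> lip_at f t -> lip_at (fun s => (f s)^-1) t.
Proof.
move=> ft0 [c c0 fc]; set a := normc (f t).
have a0 : 0 < a.
  rewrite lt_def normc_ge0 andbT.
  by apply: contra ft0 => /eqP/Normc.eq0_normc->.
(* Close to [t] the modulus of [f s] stays above [a / 2], so that of [f t * f s] is at least
   [a * (a / 2)]. *)
exists (c / (a * (a / 2))).
  by rewrite divr_ge0// !mulr_ge0 ?ltW// divr_gt0.
near=> s.
have fs : normc (f s - f t) <= c * `|s - t| by near: s.
(* Dividing by [c + 1] rather than [c] covers the case [c = 0]. *)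
have s1 : `|s - t| < a / 2 / (c + 1).
  near: s; apply: near_dist_lt; rewrite !divr_gt0// ltr_wpDl//.
have fs' : a / 2 <= normc (f s).
  have : c * `|s - t| <= a / 2.
    move: s1; rewrite ltr_pdivlMr ?ltr_wpDl// mulrDr mulr1 mulrC => s1.
    by apply: ltW; apply: le_lt_trans s1; rewrite lerDl.
  have : a <= normc (f s) + normc (f s - f t).
    rewrite /a -[in leLHS](subKr (f s) (f t)) (le_trans (ler_normcD _ _))//.
    by rewrite normcN.
  lra.
have fs0 : f s != 0.
  apply: contraTneq fs' => ->; rewrite Normc.normc0 -ltNge divr_gt0//.
have -> : (f s)^-1 - (f t)^-1 = (f t - f s) * (f t * f s)^-1.
  by field; rewrite fs0 ft0.
rewrite Normc.normcM Normc.normcV normc_distC mulrAC.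
rewrite ler_pM ?normc_ge0 ?invr_ge0 ?normc_ge0//.
rewrite Normc.normcM lef_pV2 ?posrE ?mulr_gt0 ?divr_gt0//.
  by rewrite ler_wpM2l// ltW.
by rewrite (lt_le_trans _ fs')// divr_gt0.
Unshelve. all: by end_near. Qed.

Lemma lip_at_sum (I : Type) (r : seq I) (P : pred I) (F : I -> R -> R[i]) t :
  (forall i, P i -> lip_at (F i) t) ->
  lip_at (fun s => \sum_(i <- r | P i) F i s) t.
Proof.
move=> h; elim: r => [|x r IH].
  by under [X in lip_at X]funext do rewrite big_nil; exact: lip_at_cst.
under [X in lip_at X]funext do rewrite big_cons.
by have [Px|//] := boolP (P x); apply: lip_atD => //; exact: h.
Qed.

Lemma lip_at_prod (I : Type) (r : seq I) (P : pred I) (F : I -> R -> R[i]) t :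
  (forall i, P i -> lip_at (F i) t) ->
  lip_at (fun s => \prod_(i <- r | P i) F i s) t.
Proof.
move=> h; elim: r => [|x r IH].
  by under [X in lip_at X]funext do rewrite big_nil; exact: lip_at_cst.
under [X in lip_at X]funext do rewrite big_cons.
by have [Px|//] := boolP (P x); apply: lip_atM => //; exact: h.
Qed.

Lemma lip_atX f n t : lip_at f t -> lip_at (fun s => f s ^+ n) t.
Proof.
move=> ft; elim: n => [|n IH]; first exact: lip_at_cst.
under [X in lip_at X]funext do rewrite exprS.
exact: lip_atM.
Qed.

Lemma lip_at_horner (p : {poly R[i]}) f t :
  lip_at f t -> lip_at (fun s => p.[f s]) t.
Proof.
move=> ft; under [X in lip_at X]funext do rewrite horner_coef.
by apply: lip_at_sum => i _; apply: lip_atM; [exact: lip_at_cst|exact: lip_atX].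
Qed.

Lemma lip_at_scale f a t : lip_at f (a * t) -> lip_at (fun s => f (a * s)) t.
Proof.
move=> [c c0 fc]; exists (c * `|a|); first by rewrite mulr_ge0.
have cv : a * s @[s --> t] --> a * t.
  by apply: cvgM; [exact: cvg_cst|exact: cvg_id].
have {}fc : \forall s \near t,
    normc (f (a * s) - f (a * t)) <= c * `|a * s - a * t|.
  exact: (cv _ fc).
near=> s; rewrite -mulrA -normrM mulrBr; near: s; exact: fc.
Unshelve. all: by end_near.
Qed.

Lemma lip_at_expi t : lip_at (@expi R) t.
Proof.
by exists 1 => //; near=> s; rewrite mul1r expi_lipschitz.
Unshelve. all: by end_near. Qed.

(** Absence of a pole means that the reduced denominator does not vanish at [f t], so the quotient
    of the two polynomials inherits the estimate. *)
Lemma lip_at_rat_eval (F : {fraction {poly R[i]}}) f t : ~~ rat_pole F (f t) ->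
  lip_at f t -> lip_at (fun s => rat_eval F (f s)) t.
Proof.
move=> Ft ft; apply: lip_atM; first exact: lip_at_horner.
by apply: lip_atV; [exact: Ft|exact: lip_at_horner].
Qed.

Lemma lip_at_mulmx (m n p : nat) (A : R -> 'M[R[i]]_(m, n))
    (B : R -> 'M[R[i]]_(n, p)) t :
  (forall i j, lip_at (fun s => A s i j) t) ->
  (forall i j, lip_at (fun s => B s i j) t) ->
  forall i j, lip_at (fun s => (A s *m B s) i j) t.
Proof.
move=> hA hB i j; under [X in lip_at X]funext do rewrite mxE.
by apply: lip_at_sum => k _; exact: lip_atM.
Qed.

Lemma lip_at_dominated_continuous f (u : R -> R) t : lip_at f t ->
  (forall s, `|u s - u t| <= normc (f s - f t)) -> {for t, continuous u}.
Proof.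
move=> [c c0 fc] uf; apply/cvgrPdist_lt => e e0; near=> s.
have fs : normc (f s - f t) <= c * `|s - t| by near: s.
have s1 : `|s - t| < e / (c + 1).
  by near: s; apply: near_dist_lt; rewrite !divr_gt0// ltr_wpDl.
rewrite distrC (le_lt_trans (uf s))// (le_lt_trans fs)//.
move: s1; rewrite ltr_pdivlMr ?ltr_wpDl// mulrDr mulr1 mulrC.
by apply: le_lt_trans; rewrite lerDl.
Unshelve. all: by end_near. Qed.

Lemma lip_at_continuous_Re f t :
  lip_at f t -> {for t, continuous (fun s => complex.Re (f s))}.
Proof.
move=> /lip_at_dominated_continuous; apply => s.
by rewrite -raddfB normc_ge_normRe.
Qed.

Lemma lip_at_continuous_Im f t :
  lip_at f t -> {for t, continuous (fun s => complex.Im (f s))}.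
Proof.
move=> /lip_at_dominated_continuous; apply => s.
by rewrite -raddfB normc_ge_normIm.
Qed.

End LocallyLipschitz.

(** * Infinite products of low-pass filters *)

Section ComplexLimits.
Context {R : realType}.
Local Notation normc := Normc.normc.

Lemma cvg_complex (u : nat -> R[i]) (l : R[i]) :
  complex.Re (u n) @[n --> \oo] --> complex.Re l ->
  complex.Im (u n) @[n --> \oo] --> complex.Im l -> u n @[n --> \oo] --> l.
Proof.
move=> ur ui; apply/cvgrPdist_lt => e e0.
(* A positive element of [R[i]] has zero imaginary part, so the tolerance [e] is a real number. *)
have re0 : 0 < complex.Re e / 2.
  by move: e0; rewrite ltcE => /andP[_ ?]; rewrite divr_gt0.
have eE : e = (complex.Re e)%:C%C by rewrite RRe_real// gtr0_real.
near=> n; rewrite eE -[`|_|]/((normc _)%:C%C) ltcR.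
rewrite (le_lt_trans (normc_le_ReIm _))//.
rewrite [ltRHS]splitr !raddfB ltrD//; near: n.
  by move/cvgrPdist_lt : ur; exact.
by move/cvgrPdist_lt : ui; exact.
Unshelve. all: by end_near. Qed.

(** The telescoping series of [v] converges absolutely, by comparison with a geometric series. *)
Lemma geometric_increments_is_cvgn (v : nat -> R) (c q : R) : 0 <= q < 1 ->
  (forall n, `|v n.+1 - v n| <= c * q ^+ n) -> cvgn v.
Proof.
move=> /andP[q0 q1] vq.
have : cvgn (series (telescope v)).
  apply: normed_cvg; apply: (@series_le_cvg _ _ (geometric c q)) => //.
  - by move=> n /=; exact: normr_ge0.
  - by move=> n; exact: le_trans (normr_ge0 _) (vq n).
  - by apply: is_cvg_geometric_series; rewrite ger0_norm.
move=> h; rewrite (funext (eq_sum_telescope v)).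
by apply: is_cvgD => //; exact: is_cvg_cst.
Qed.

Lemma geometric_increments_cvg_complex (u : nat -> R[i]) (c q : R) :
  0 <= q < 1 ->
  (forall n, normc (u n.+1 - u n) <= c * q ^+ n) ->
  let l := Complex (limn (fun n => complex.Re (u n)))
                   (limn (fun n => complex.Im (u n))) in
  [/\ complex.Re (u n) @[n --> \oo] --> complex.Re l,
      complex.Im (u n) @[n --> \oo] --> complex.Im l &
      u n @[n --> \oo] --> l].
Proof.
move=> q01 uq l.
have ur : complex.Re (u n) @[n --> \oo] --> complex.Re l.
  apply: (@geometric_increments_is_cvgn _ c q) => // n.
  by rewrite -raddfB (le_trans (normc_ge_normRe _)).
have ui : complex.Im (u n) @[n --> \oo] --> complex.Im l.
  apply: (@geometric_increments_is_cvgn _ c q) => // n.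
  by rewrite -raddfB (le_trans (normc_ge_normIm _)).
by split => //; exact: cvg_complex.
Qed.

Lemma sqr_normcE (z : R[i]) :
  normc z ^+ 2 = complex.Re z ^+ 2 + complex.Im z ^+ 2.
Proof. by case: z => a b /=; rewrite sqr_sqrtr// addr_ge0 ?sqr_ge0. Qed.

End ComplexLimits.

(** * Convergence and L_2 bound for a function [g] modelled on t |-> m(exp(2 pi i t)) *)

Section InfiniteProduct.
Context {R : realType} (N : nat) (g : R -> R[i]).
Context (N2 : (2 <= N)%N) (g_lip : forall t, lip_at g t) (g0 : g 0 = 1)
  (g_periodic : forall t, g (t + 1) = g t)
  (g_sum : forall t, \sum_(j < N) Normc.normc (g (t + j%:R / N%:R)) ^+ 2 = 1).
Local Notation normc := Normc.normc.
Local Notation mu := (@lebesgue_measure R).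

Let P (K : nat) (w : R) : R[i] := \prod_(1 <= k < K.+1) g (w / N%:R ^+ k).
Let F (K : nat) (w : R) : R := normc (P K w) ^+ 2.

Let N_gt0 : 0 < N%:R :> R.
Proof. by rewrite ltr0n; apply: ltn_trans N2. Qed.

Let N_neq0 : N%:R != 0 :> R. Proof. by rewrite gt_eqF. Qed.

Let PS K w : P K.+1 w = P K w * g (w / N%:R ^+ K.+1).
Proof. by rewrite /P big_nat_recr. Qed.

Let g_periodicn t n : g (t + n%:R) = g t.
Proof.
elim: n => [|n IH]; first by rewrite addr0.
by rewrite -natr1 addrA g_periodic.
Qed.

Let normc_g_le1 t : normc (g t) <= 1.
Proof.
have := g_sum t; rewrite (bigD1 (Ordinal (ltnW N2)))//= mul0r addr0 => h.
have : normc (g t) ^+ 2 <= 1.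
  by rewrite -[leRHS]h lerDl sumr_ge0// => j _; exact: sqr_ge0.
by rewrite -[leRHS](expr1n _ 2) ler_pXn2r// ?nnegrE ?normc_ge0.
Qed.

Let normc_P_le1 K w : normc (P K w) <= 1.
Proof.
elim: K => [|K IH]; first by rewrite /P big_geq// Normc.normc1.
by rewrite PS Normc.normcM mulr_ile1 ?normc_ge0.
Qed.

Let g_sub1 : exists2 c : R, 0 <= c & forall t, normc (g t - 1) <= c * `|t|.
Proof.
have [c c0] := g_lip 0; rewrite g0 => /nbhs_ballP[d /= d0 gd].
(* The local constant [c] serves for [|t| < d]; elsewhere [|g t - 1| <= 2 <= (2 / d) |t|], as
   [|g| <= 1]. *)
exists (Num.max c (2 / d)); first by rewrite le_max c0.
move=> t; have [td|td] := ltP `|t| d.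
  rewrite (@le_trans _ _ (c * `|t|))//.
    by have := gd t; rewrite /ball /= sub0r normrN subr0; apply.
  by rewrite ler_wpM2r// le_max lexx.
rewrite (@le_trans _ _ (2 / d * `|t|))//; last first.
  by rewrite ler_wpM2r// le_max lexx orbT.
rewrite mulrAC ler_pdivlMr// (@le_trans _ _ (2 * d)) ?ler_wpM2l//.
rewrite ler_wpM2r ?(ltW d0)// (le_trans (ler_normcD _ _))// normcN.
by rewrite Normc.normc1 -[leRHS](natrD _ 1 1) lerD.
Qed.

(** The increment is [P K w] times [g (w / N^(K+1)) - 1]: the first factor has modulus at most 1,
    the second is at most a multiple of [|w| / N^(K+1)]. The constant depends on [w], which suffices
    for pointwise convergence. *)
Let P_increment w : exists c : R, forall K,
  normc (P K.+1 w - P K w) <= c * (N%:R^-1) ^+ K.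
Proof.
have [c c0 gc] := g_sub1; exists (c * `|w|) => K.
rewrite PS -[X in _ - X]mulr1 -mulrBr Normc.normcM.
rewrite (@le_trans _ _ (normc (g (w / N%:R ^+ K.+1) - 1)))//.
  by rewrite ler_piMl ?normc_ge0.
rewrite (le_trans (gc _))// -mulrA ler_wpM2l// normrM ler_wpM2l// -exprVn.
have q0 : 0 <= N%:R^-1 :> R by rewrite invr_ge0 ltW.
rewrite ger0_norm ?exprn_ge0// exprS ler_piMl ?exprn_ge0//.
by rewrite invf_le1// ler1n ltnW.
Qed.

(** Serves to make the partial products continuous, hence measurable. *)
Let P_lip K t : lip_at (P K) t.
Proof.
apply: lip_at_prod => k _.
under [X in lip_at X]funext do rewrite mulrC.
exact: lip_at_scale.
Qed.

Let measurable_ReP K : measurable_fun setT (fun w => complex.Re (P K w)).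
Proof.
by apply: continuous_measurable_fun => t; exact: lip_at_continuous_Re.
Qed.

Let measurable_ImP K : measurable_fun setT (fun w => complex.Im (P K w)).
Proof.
by apply: continuous_measurable_fun => t; exact: lip_at_continuous_Im.
Qed.

Let measurable_F K : measurable_fun setT (F K).
Proof.
rewrite /F; under [X in measurable_fun _ X]funext do rewrite sqr_normcE.
by apply: measurable_funD; exact: measurable_funX.
Qed.

Let F_ge0 K w : 0 <= F K w. Proof. exact: sqr_ge0. Qed.

(** For [k <= K] the shift [j N^K / N^k] is an integer, so periodicity fixes the first [K] factors.
    The last one is shifted by [j / N], and the sum rule applies to it. *)
Let F_fold K w : \sum_(j < N) F K.+1 (w + j%:R * N%:R ^+ K) = F K w.
Proof.
have NK n : N%:R ^+ n != 0 :> R by rewrite expf_neq0.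
have shift (j : 'I_N) : F K.+1 (w + j%:R * N%:R ^+ K) =
    F K w * normc (g (w / N%:R ^+ K.+1 + j%:R / N%:R)) ^+ 2.
  rewrite /F PS Normc.normcM exprMn; congr (normc _ ^+ 2 * normc (g _) ^+ 2).
    apply: eq_big_nat => k /andP[k1 kK].
    have NKk : N%:R ^+ K = N%:R ^+ (K - k) * N%:R ^+ k :> R.
      by rewrite -exprD subnK.
    rewrite mulrDl NKk mulrA mulfK//.
    by rewrite -(natrX _ N (K - k)) -natrM g_periodicn.
  by rewrite exprS; field; rewrite NK N_neq0.
by under eq_bigr do rewrite shift; rewrite -mulr_sumr g_sum mulr1.
Qed.

(** Folding reduces [K + 1] to [K]; for [K = 0] the empty product is integrated over an interval of
    length 1. *)
Let integral_F K a : (\int[mu]_(x in `[a, (a + N%:R ^+ K)%R[) (F K x)%:E = 1)%E.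
Proof.
elim: K a => [|K IH] a; last first.
  rewrite exprS ge0_integral_itv_fold ?exprn_ge0 ?ltW//.
  by under eq_integral do rewrite F_fold; exact: IH.
under eq_integral do rewrite /F /P big_geq// Normc.normc1 expr1n.
rewrite integral_cst//= mul1e lebesgue_measure_itv/= lte_fin ltrDl ltr01.
by rewrite -EFinB addrAC subrr add0r.
Qed.

Lemma infinite_product_square_integrable : exists2 phi : R -> R[i],
  forall w, \prod_(1 <= k < K.+1) g (w / N%:R ^+ k) @[K --> \oo] --> phi w
  & square_integrable phi.
Proof.
pose phi w := Complex (limn (fun n => complex.Re (P n w)))
                      (limn (fun n => complex.Im (P n w))).
have Ninv : 0 <= (N%:R^-1 : R) < 1.
  by rewrite invr_ge0 ltW//= invf_lt1// ltr1n.
have Pphi w : [/\ complex.Re (P n w) @[n --> \oo] --> complex.Re (phi w),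
      complex.Im (P n w) @[n --> \oo] --> complex.Im (phi w) &
      P n w @[n --> \oo] --> phi w].
  have [c hc] := P_increment w.
  exact: geometric_increments_cvg_complex Ninv hc.
exists phi; first by move=> w; have [] := Pphi w.
split.
- apply: (measurable_fun_cvg measurable_ReP) => w _; by have [] := Pphi w.
- apply: (measurable_fun_cvg measurable_ImP) => w _; by have [] := Pphi w.
pose I n : set R :=
  `[(- (N%:R ^+ n / 2)), (- (N%:R ^+ n / 2) + N%:R ^+ n)[%classic.
(* Extension by 0 outside [I n] lets Fatou's lemma be applied on the whole line, although the
   intervals vary with [n]. *)
pose f n : R -> \bar R := (EFin \o F n) \_ (I n).
have f_phi w : limn_einf (f ^~ w) = (normc (phi w) ^+ 2)%:E.
  suff h : f ^~ w @ \oo --> (normc (phi w) ^+ 2)%:E.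
    rewrite is_cvg_limn_einfE//; last by apply/cvg_ex; eexists; exact: h.
    exact/cvg_lim.
  have h : F n w @[n --> \oo] --> normc (phi w) ^+ 2.
    have [hr hi _] := Pphi w.
    rewrite sqr_normcE /F; under [X in X @ _]funext do rewrite sqr_normcE.
    by apply: cvgD; apply: cvgM.
  have hE : (F n w)%:E @[n --> \oo] --> (normc (phi w) ^+ 2)%:E.
    (* Any fixed [w] eventually lies in [I n], so the truncation does not affect the limit. *)
    by apply: cvg_EFin => //; exact: nearW.
  apply: cvg_trans hE.
  apply: near_eq_cvg; near=> n.
  rewrite /f /patch ifT// inE /I /= in_itv/=.
  have wn : `|w| < N%:R ^+ n / 2.
    near: n.
    (* The chain is [2 |w| < n0 <= n < N^n], with [n0] an Archimedean bound. *)
    have wn0 := archi_boundP (mulr_ge0 (ler0n R 2) (normr_ge0 w)).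
    exists (Num.bound (2 * `|w|)) => // n /= n0n.
    rewrite ltr_pdivlMr// mulrC (lt_le_trans wn0)//.
    by rewrite -natrX ler_nat (leq_trans n0n)// ltnW// ltn_expl.
  by move: wn; rewrite ltr_norml => /andP[]; lra.
have mf n : measurable_fun setT (f n).
  apply/(measurable_restrictT _ _).1; first exact: measurable_itv.
  by apply/measurable_EFinP; exact: measurable_funTS.
have f0 n x : setT x -> (0 <= f n x)%E.
  by move=> _; rewrite /f /patch; case: ifP => // _; rewrite lee_fin.
have := fatou mu measurableT mf f0.
under eq_integral do rewrite f_phi.
move=> /le_lt_trans; apply.
(* All the truncated integrals equal 1, so their lower limit is 1 and finite. *)
rewrite (_ : (fun n => _) = cst 1%E); last first.
  by apply/funext => n; rewrite /f -integral_mkcond integral_F.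
rewrite is_cvg_limn_einfE; last exact: is_cvg_cst.
by rewrite lim_cst// ltry.
Unshelve. all: by end_near. Qed.

End InfiniteProduct.

(** * Wavelet filters *)

(** This is the [i]-th diagonal entry of [A A^* = 1], brought back from [R[i]] to [R]. *)
Lemma unitarymx_row_norm (R : realType) (n : nat) (A : 'M[R[i]]_n) i :
  A \is unitarymx -> \sum_(j < n) Normc.normc (A i j) ^+ 2 = 1.
Proof.
move=> /unitarymxP/matrixP/(_ i i); rewrite !mxE eqxx => h.
apply: (@complexI R); rewrite rmorph_sum rmorph1; apply: etrans h.
by apply: eq_bigr => j _; rewrite !mxE rmorphXn; exact: sqr_normc.
Qed.

Section LowPassFilter.
Context {R : realType} (N : nat) (U : 'M[{fraction {poly R[i]}}]_N).
Context (N2 : (2 <= N)%N) (unitU : unitary_on_circle U).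
Local Notation normc := Normc.normc.
Let M (t : R) : 'M[R[i]]_N := wavelet_filter U (expi (2 * pi * t)).

Let N_gt0 : (0 < N)%N. Proof. exact: ltnW N2. Qed.

Let N_neq0 : N%:R != 0 :> R. Proof. by rewrite pnatr_eq0 -lt0n. Qed.

Lemma mx_eval_unitary (z : R[i]) : `|z| = 1 -> mx_eval U z \is unitarymx.
Proof. by move=> /unitU[]. Qed.

Lemma delay_unitary (t : R) : delay_mx N (expi t) \is unitarymx.
Proof.
apply/unitarymxP; rewrite /delay_mx tr_diag_mx map_diag_mx mulmx_diag.
rewrite -diag_const_mx; congr diag_mx; apply/rowP => j.
rewrite !mxE /= -expiMn -expiN expi_conj.
by rewrite -expiD subrr expi0.
Qed.

Lemma delay_mulmxE (z : R[i]) (B : 'M[R[i]]_N) k l :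
  (delay_mx N z *m B) k l = z ^- k * B k l.
Proof. by rewrite /delay_mx mul_diag_mx !mxE. Qed.

Lemma wavelet_filter_unitary (t : R) : M t \is unitarymx.
Proof.
rewrite /M /wavelet_filter !mul_unitarymx ?dft_unitary ?delay_unitary//.
- rewrite trmxC_unitary mul_unitarymx ?dft_unitary// mx_eval_unitary//.
  exact: normr1.
- by rewrite mx_eval_unitary// normrX norm_expi expr1n.
Qed.

Lemma wavelet_filter_1 : M 0 = 1%:M.
Proof.
rewrite /M /wavelet_filter mulr0 expi0 expr1n.
have -> : delay_mx N (1 : R[i]) = 1%:M.
  rewrite /delay_mx -diag_const_mx; congr diag_mx; apply/rowP => j.
  by rewrite !mxE expr1n invr1.
(* With [X = U(1) V] the goal is [X^* X = 1]; unitarity provides [X X^* = 1], and one-sided inverses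
   of square matrices are two-sided. *)
rewrite mulmx1 -mulmxA; apply: mulmx1C; apply/unitarymxP.
rewrite mul_unitarymx ?dft_unitary// mx_eval_unitary//.
exact: normr1.
Qed.

(* Multiplying z by exp(2 pi i j / N) leaves z^N unchanged, and the columns of
   Delta(exp(2 pi i j / N)) V are those of V shifted by j. *)
Lemma wavelet_filter_shift (t : R) (i j i0 : 'I_N) : i0 = 0%N :> nat ->
  M (t + j%:R / N%:R) i i0 = M t i j.
Proof.
move=> i00; rewrite /M /wavelet_filter.
have zE : expi (2 * pi * (t + j%:R / N%:R)) =
    expi (2 * pi * t) * expi (2 * pi * j%:R / N%:R).
  by rewrite -expiD; congr expi; ring.
have zN : expi (2 * pi * (t + j%:R / N%:R)) ^+ N = expi (2 * pi * t) ^+ N.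
  by rewrite zE exprMn -[X in _ * X]expiMn divfK// expi2piMn mulr1.
rewrite zN; move: (_ *m mx_eval _ _) => A.
(* The identities below are applied with explicit sides: rewriting with mulmxA
   would try to unify the factors by unfolding them. *)
have mulE (B C : 'M[R[i]]_N) l :
    (A *m B *m C) i l = \sum_k A i k * (B *m C) k l.
  by rewrite -mulmxA mxE.
apply: etrans (mulE _ _ _) (etrans _ (esym (mulE _ _ _))).
apply: eq_bigr => k _; apply: (congr1 ( *%R (A i k))).
apply: etrans (delay_mulmxE _ _ _ _) (etrans _ (esym (delay_mulmxE _ _ _ _))).
rewrite zE exprMn invfM -[LHS]mulrA; congr (_ * _).
rewrite !mxE i00.
rewrite mulr0 mul0r oppr0 expi0 mulr1 mulrC; congr (_ * _).
rewrite -expiMn -expiN; congr expi; ring.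
Qed.

(** Each factor of the product is treated entrywise: [z^N] stays on the circle, where [U] has no
    pole, and the powers of [z] inverted by the delays do not vanish. *)
Lemma lip_at_wavelet_filter (t : R) i j : lip_at (fun s => M s i j) t.
Proof.
have lipe s : lip_at (fun s => expi (2 * pi * s)) s.
  exact: (lip_at_scale (lip_at_expi (2 * pi * s))).
move: i j; apply: lip_at_mulmx; last by move=> i j; exact: lip_at_cst.
apply: lip_at_mulmx.
  apply: lip_at_mulmx; first by move=> i j; exact: lip_at_cst.
  move=> i j; under [X in lip_at X]funext do rewrite mxE.
  apply: lip_at_rat_eval; last exact: lip_atX.
  by have [] := unitU (_ : `|expi (2 * pi * t) ^+ N| = 1);
    [rewrite normrX norm_expi expr1n|].
move=> i j; under [X in lip_at X]funext do rewrite !mxE.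
have [_|_] := eqVneq i j; last exact: lip_at_cst.
apply: lip_atV; last exact: lip_atX.
by rewrite expf_neq0// expi_neq0.
Qed.

Lemma wavelet_filter_periodic (t : R) : M (t + 1) = M t.
Proof. by rewrite /M mulrDr mulr1 expiD expi2pi mulr1. Qed.

(** The shifted values are the entries of row [i0] of the unitary matrix [M t]. *)
Lemma sum_low_pass_shifts (i0 : 'I_N) (t : R) : i0 = 0%N :> nat ->
  \sum_(j < N) normc (M (t + j%:R / N%:R) i0 i0) ^+ 2 = 1.
Proof.
move=> i00; under eq_bigr do rewrite wavelet_filter_shift//.
exact: unitarymx_row_norm (wavelet_filter_unitary t).
Qed.

End LowPassFilter.

Theorem theorem6p2 (R : realType) (N : nat) (hN : (2 <= N)%N)
    (U : 'M[{fraction {poly R[i]}}]_N)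
    (hU : unitary_on_circle U)
    (hpole : forall z : R[i], 1 < `|z| -> no_pole U z) :
  let i0 : 'I_N := Ordinal (ltnW hN) in
  let m (z : R[i]) : R[i] := wavelet_filter U z i0 i0 in
  exists2 phi : R -> R[i],
    forall w : R,
      (fun K : nat => \prod_(1 <= k < K.+1) m (expi (2 * pi * w / N%:R ^+ k)))
        @ \oo --> phi w
    & square_integrable phi.
Proof.
(* In the variable [t], the filter on the circle becomes a function of period 1, as the product
   theorem expects. *)
move=> i0 m; pose g (t : R) := m (expi (2 * pi * t)).
have [||||phi hphi sphi] := @infinite_product_square_integrable R N g hN.
- by move=> t; exact: lip_at_wavelet_filter.
- by rewrite /g /m wavelet_filter_1// !mxE eqxx.
- by move=> t; rewrite /g /m wavelet_filter_periodic.
- by move=> t; exact: sum_low_pass_shifts.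
exists phi => [w|]; last exact: sphi.
rewrite (_ : (fun K => _) = (fun K => \prod_(1 <= k < K.+1) g (w / N%:R ^+ k))).
  exact: hphi.
by apply/funext => K; apply: eq_bigr => k _; rewrite /g mulrA.
Qed.
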